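(* Let $\Omega\subset\mathbb{R}^d$ be a bounded set with a Lipschitz boundary that satisfies an interior cone condition, let $q\in[1,\infty]$, $m\in\mathbb{N}_0$, and let $k$ be a Sobolev kernel on $\Omega$ of order $\tau>m+d/2$. Let $C_{m,q},h_{0,m,q}>0$ and $C_{0,2},h_{0,0,2}>0$ be constants as in the standard interpolation error bound (stated in the context) for the pairs $(m,q)$ and $(0,2)$ respectively. Let $\theta\in[0,1]$. Then for all $v\in\mathcal{H}_{1+\theta}(\Omega)$ and all finite $X\subset\Omega$ with $h_X\le h_{0,0,2}$ it holds $$\|v-I_Xv\|_{\mathcal{H}(\Omega)}\le C_{0,2}^\theta\, h_X^{\theta\tau}\,\|v\|_{\mathcal{H}_{1+\theta}(\Omega)}.$$ In particular, for $h_X\le\min\{h_{0,m,q},h_{0,0,2}\}$ it holds $$|v-I_Xv|_{W_q^m(\Omega)}\le C_{m,q}\,C_{0,2}^\theta\, h_X^{(1+\theta)\tau-m-d(1/2-1/q)_+}\,\|v\|_{\mathcal{H}_{1+\theta}(\Omega)}.$$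
   Context: $\mathcal{H}(\Omega)$ is the reproducing kernel Hilbert space of the positive definite kernel $k\colon\Omega\times\Omega\to\mathbb{R}$. For $\tau>0$, $H^\tau(\mathbb{R}^d)=\{f\in L_2(\mathbb{R}^d):\|f\|^2_{H^\tau(\mathbb{R}^d)}:=\int_{\mathbb{R}^d}(1+\|\omega\|_2^2)^\tau|\hat f(\omega)|^2\,\mathrm{d}\omega<\infty\}$, and $H^\tau(\Omega)$ is the space of restrictions to $\Omega$ with norm $\|f\|_{H^\tau(\Omega)}=\inf\{\|f_e\|_{H^\tau(\mathbb{R}^d)}: f=f_e|_\Omega\}$. $k$ is a Sobolev kernel of order $\tau>d/2$ if $\mathcal{H}(\Omega)$ is norm equivalent to $H^\tau(\Omega)$. The seminorm is $|u|_{W_q^m(\Omega)}=\big(\sum_{|\alpha|=m}\|D^\alpha u\|^q_{L_q(\Omega)}\big)^{1/q}$, with the usual modification for $q=\infty$; $(x)_+:=\max(0,x)$. For a finite set $X=\{x_1,\dots,x_n\}\subset\Omega$, $h_X:=\sup_{x\in\Omega}\min_{x_j\in X}\|x-x_j\|_2$ is the fill distance, and $I_X\colon\mathcal{H}(\Omega)\to\operatorname{span}\{k(\cdot,x_1),\dots,k(\cdot,x_n)\}$ is the kernel interpolation operator ($(I_Xf)(x_i)=f(x_i)$ for all $i$), which is the $\mathcal{H}(\Omega)$-orthogonal projection onto this span. Standard interpolation error bound (a known result defining the constants): for $\Omega$ as in the claim, $m'\in\mathbb{N}_0$, $q'\in[1,\infty]$ and $k$ a Sobolev kernel of order $\tau>m'+d/2$,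 there are constants $C_{m',q'},h_{0,m',q'}>0$ such that for all finite $X\subset\Omega$ with $h_X\le h_{0,m',q'}$, $$|f-I_Xf|_{W_{q'}^{m'}(\Omega)}\le C_{m',q'}\,h_X^{\tau-m'-d(1/2-1/q')_+}\,\|f-I_Xf\|_{\mathcal{H}(\Omega)}\quad\text{for all } f\in\mathcal{H}(\Omega).$$ Standing assumption (Mercer): $(Tf)(x):=\int_\Omega k(x,y)f(y)\,\mathrm{d}y$ defines a linear integral operator $T\colon L_2(\Omega)\to L_2(\Omega)$ with countably many $L_2(\Omega)$-orthonormal eigenfunctions $\{\varphi_j\}_{j=1}^\infty$ and positive eigenvalues $\{\lambda_j\}_{j=1}^\infty$ such that $\{\lambda_j^{1/2}\varphi_j\}_{j=1}^\infty$ is an orthonormal basis of $\mathcal{H}(\Omega)$; every $f\in L_2(\Omega)$ satisfies $f=\sum_j\langle f,\varphi_j\rangle_{L_2(\Omega)}\varphi_j$. Power spaces: for $\theta\ge0$, $\mathcal{H}_\theta(\Omega):=\{f=\sum_j\langle f,\varphi_j\rangle_{L_2(\Omega)}\varphi_j:\ \|f\|^2_{\mathcal{H}_\theta(\Omega)}:=\sum_j\lambda_j^{-\theta}|\langle f,\varphi_j\rangle_{L_2(\Omega)}|^2<\infty\}$. *)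

(* Defs.v *)
From HB Require Import structures.
From mathcomp Require Import all_boot all_order all_algebra.
From mathcomp Require Import all_classical all_reals all_analysis.
From mathcomp Require Import complex.

Set Implicit Arguments.
Unset Strict Implicit.
Unset Printing Implicit Defensive.
Import Order.TTheory GRing.Theory Num.Theory.
Import numFieldNormedType.Exports.
Local Open Scope classical_set_scope.
Local Open Scope ring_scope.

(* R^d is 'rV[R]_d. Its library norm is the maximum norm, which induces the
   right topology; the Euclidean norm is introduced separately. *)
Section Euclidean.
Variables (R : realType) (d : nat).
Implicit Types x y : 'rV[R]_d.

Definition dotv x y : R := \sum_(i < d) x ord0 i * y ord0 i.

Definition enorm x : R := Num.sqrt (dotv x x).

End Euclidean.

(* Lebesgue measure on R^d: the outer measure given by countable covers by
   half-open boxes, restricted to its Caratheodory-measurable sets.  None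
   encodes the empty set, so that finite covers are allowed. *)
Section Lebesgue.
Variables (R : realType) (d : nat).
Local Open Scope ereal_scope.

Definition box (o : option ('rV[R]_d * 'rV[R]_d)) : set 'rV[R]_d :=
  if o is Some (a, b) then
    [set x | forall i, (a ord0 i <= x ord0 i < b ord0 i)%R]
  else set0.

Definition box_volume (o : option ('rV[R]_d * 'rV[R]_d)) : \bar R :=
  if o is Some (a, b) then
    (\prod_(i < d) Num.max 0 (b ord0 i - a ord0 i))%R%:E
  else 0.

Definition leb_outer (A : set 'rV[R]_d) : \bar R :=
  ereal_inf [set \sum_(k <oo) box_volume (F k)
            | F in [set F : nat -> option ('rV[R]_d * 'rV[R]_d)
                   | A `<=` \bigcup_k box (F k)]].

Lemma box_volume_ge0 o : 0 <= box_volume o.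
Proof.
case: o => [[a b]|//]; rewrite /box_volume lee_fin prodr_ge0// => i _.
by rewrite le_max lexx.
Qed.
#[local] Hint Resolve box_volume_ge0 : core.

Lemma leb_outer_ge0 A : 0 <= leb_outer A.
Proof.
by apply: le_ereal_inf_tmp => x [F AF <-{x}]; exact: nneseries_ge0.
Qed.

Lemma leb_outer0 : leb_outer set0 = 0.
Proof.
apply/eqP; rewrite eq_le; apply/andP; split; last exact: leb_outer_ge0.
apply: ereal_inf_lbound; exists (fun=> None) => //.
by rewrite eseries0.
Qed.

Lemma le_leb_outer : {homo leb_outer : A B / A `<=` B >-> A <= B}.
Proof.
move=> A B AB; apply/ereal_inf_le_tmp => x [F BF <-{x}].
by exists F => //; exact: subset_trans AB BF.
Qed.

Lemma leb_outer_sigma_subadditive : sigma_subadditive leb_outer.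
Proof.
move=> A; have [[i ioo]|] := pselect (exists i, leb_outer (A i) = +oo).
  rewrite (eseries_pinfty _ _ ioo) ?leey// => n _.
  by rewrite -ltNye (lt_le_trans _ (leb_outer_ge0 _)).
rewrite -forallNE => Aoo.
suff add2e (e : {posnum R}) :
    leb_outer (\bigcup_n A n) <= \sum_(i <oo) leb_outer (A i) + e%:num%:E.
  by apply/lee_addgt0Pr => _/posnumP[].
rewrite (le_trans _ (epsilon_trick _ _ _))//; last first.
  by move=> n; exact: leb_outer_ge0.
pose P n (F : nat -> option ('rV[R]_d * 'rV[R]_d)) :=
  A n `<=` \bigcup_k box (F k) /\
  \sum_(k <oo) box_volume (F k)
    <= leb_outer (A n) + (e%:num / (2 ^ n.+1)%:R)%:E.
have [G PG] : {G & forall n, P n (G n)}.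
  apply: (@choice _ _ P) => n; rewrite /P /leb_outer.
  set S := (X in ereal_inf X); move infS : (ereal_inf S) => iS.
  case: iS infS => [r Sr|Soo|Soo].
  - have en1 : (0 < e%:num / (2 ^ n.+1)%:R)%R by [].
    have /(lb_ereal_inf_adherent en1) : ereal_inf S \is a fin_num by rewrite Sr.
    move=> [x [F AnF volF] xS].
    by exists F; split => //; rewrite volF -Sr; exact/ltW.
  - by have := Aoo n; rewrite /leb_outer Soo.
  - suff : lbound S 0 by move/le_ereal_inf_tmp; rewrite Soo.
    by move=> /= _ [F AnF <-]; exact: nneseries_ge0.
have volG_ge0 x : 0 <= (box_volume \o uncurry G) x by exact: box_volume_ge0.
apply: (@le_trans _ _ (\esum_(i in setT) (box_volume \o uncurry G) i)).
  apply: ereal_inf_lbound => /=.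
  have /card_esym/ppcard_eqP[f] := card_nat2.
  exists (uncurry G \o f).
    move=> t [i _] /(PG i).1[j _ Bijt].
    by exists (f^-1%FUN (i, j)) => //=; rewrite invK ?inE.
  rewrite -(esum_pred_image (box_volume \o uncurry G) _ xpredT)
    ?[fun=> _]set_true//.
  by rewrite image_eq.
rewrite (_ : esum _ _ = \sum_(i <oo) \sum_(j <oo ) box_volume (G i j));
  last first.
  pose J : nat -> set (nat * nat) := fun i => [set (i, j) | j in setT].
  rewrite (_ : setT = \bigcup_k J k); last first.
    by rewrite predeqE => -[a b]; split => // _; exists a => //; exists b.
  rewrite esum_bigcupT /=; last 2 first.
    - apply/trivIsetP => i j _ _ ij.
      rewrite predeqE => -[n m] /=; split => //= -[] [_] _ [<-{n} _].
      by move=> [m' _] [] /esym/eqP; rewrite (negbTE ij).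
    - by move=> /= [n m]; exact: box_volume_ge0.
  rewrite -(image_id [set: nat]) -fun_true esum_pred_image//; last first.
    by move=> n _; exact: esum_ge0.
  apply: eq_eseriesr => /= j _.
  rewrite -(esum_pred_image (box_volume \o uncurry G) (pair j) predT)//=; last first.
    by move=> ? ? _ _; exact: (@can_inj _ _ _ snd).
  by congr esum; rewrite predeqE => -[a b]; split; move=> [i _ <-]; exists i.
apply: lee_lim.
- by apply: is_cvg_nneseries => n *; exact: nneseries_ge0.
- by apply: is_cvg_nneseries => n *; apply: adde_ge0 => //; exact: leb_outer_ge0.
- by near=> n; apply: lee_sum => i _; exact: (PG i).2.
Unshelve. all: by end_near. Qed.

HB.instance Definition _ := isOuterMeasure.Build R 'rV[R]_d leb_outer
  leb_outer0 leb_outer_ge0 le_leb_outer leb_outer_sigma_subadditive.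

Definition leb : set (caratheodory_type leb_outer) -> \bar R := leb_outer.

HB.instance Definition _ := isMeasure.Build _ _ _ leb
  (@caratheodory_measure0 _ _ leb_outer) (@caratheodory_measure_ge0 _ _ leb_outer)
  (@caratheodory_measure_sigma_additive _ _ leb_outer).

End Lebesgue.
Arguments leb R d : clear implicits.

Notation leb_space R d := (caratheodory_type (@leb_outer R d)).

Section Domains.
Variables (R : realType) (d : nat).
Implicit Types Omega : set 'rV[R]_d.

(* Near each boundary point Omega is, in the direction nu, the part above a
   Lipschitz graph over the hyperplane orthogonal to nu (gamma is only evaluated
   on that hyperplane).  Points of the graph may or may not belong to Omega, so
   that Omega need not be open. *)
Definition lipschitz_boundary Omega :=
  forall p, (closure Omega `\` Omega°) p ->
  exists (nu : 'rV[R]_d) (r L : R) (gamma : 'rV[R]_d -> R),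
    [/\ dotv nu nu = 1, 0 < r,
        forall x y, `|gamma x - gamma y| <= L * enorm (x - y)
      & forall x, enorm (x - p) < r ->
          (gamma (x - dotv x nu *: nu) < dotv x nu -> Omega x) /\
          (dotv x nu < gamma (x - dotv x nu *: nu) -> ~ Omega x)].

Definition cone (x xi : 'rV[R]_d) (alpha r : R) : set 'rV[R]_d :=
  [set x + l *: y | l in `[0, r] & y in
     [set y : 'rV[R]_d | enorm y = 1 /\ cos alpha <= dotv y xi]].

Definition interior_cone_condition Omega :=
  exists alpha r : R, [/\ 0 < alpha < pi / 2, 0 < r
    & forall x, Omega x ->
        exists2 xi, enorm xi = 1 & cone x xi alpha r `<=` Omega].

End Domains.

(* The L_2 Fourier transform: the L_2 limit, as n tends to infinity, of the
   Fourier integrals over the balls of radius n, in the unitary normalization. *)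
Section SobolevWholeSpace.
Variables (R : realType) (d : nat).
Implicit Types f : 'rV[R]_d -> R.

Definition sqnormC (z : R[i]) : R :=
  complex.Re z ^+ 2 + complex.Im z ^+ 2.

Definition fourier_ball f (n : nat) (w : 'rV[R]_d) : R[i] :=
  let B := [set x : 'rV[R]_d | enorm x <= n%:R] in
  let c := (2 * pi) `^ (- (d%:R / 2)) in
  Complex (c * \int[leb R d]_(x in B) (f x * cos (dotv x w)))
          (- (c * \int[leb R d]_(x in B) (f x * sin (dotv x w)))).

Definition is_fourier f (g : 'rV[R]_d -> R[i]) :=
  [/\ ((fun w => complex.Re (g w)) : leb_space R d -> R) \in Lfun (leb R d) 2%:E,
      ((fun w => complex.Im (g w)) : leb_space R d -> R) \in Lfun (leb R d) 2%:E
    & (\int[leb R d]_w (sqnormC (g w - fourier_ball f n w))%:E)%E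
        @[n --> \oo] --> 0%E].

(* Existence and almost-everywhere uniqueness of g, for f in L_2, are
   Plancherel's theorem. *)
Definition fourier f : 'rV[R]_d -> R[i] := xget (fun=> 0) (is_fourier f).

Definition sobolev_norm (tau : R) f : \bar R :=
  ((\int[leb R d]_w
     ((1 + enorm w ^+ 2) `^ tau * sqnormC (fourier f w))%:E) `^ 2^-1)%E.

Definition sobolev (tau : R) : set ('rV[R]_d -> R) :=
  [set f | (f : leb_space R d -> R) \in Lfun (leb R d) 2%:E /\
           (sobolev_norm tau f < +oo)%E].

End SobolevWholeSpace.

Section PartialDerivatives.
Variables (R : realType) (d : nat).

Definition partial (i : 'I_d) (f : 'rV[R]_d -> R) : 'rV[R]_d -> R :=
  'D_(delta_mx ord0 i) f.

Fixpoint Ck (n : nat) (f : 'rV[R]_d -> R) : Prop :=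
  continuous f /\
  if n is n'.+1 then
    forall i, (forall x, derivable f x (delta_mx ord0 i)) /\ Ck n' (partial i f)
  else True.

Definition mpartial (a : 'I_d -> nat) (f : 'rV[R]_d -> R) : 'rV[R]_d -> R :=
  foldr (fun i g => iter (a i) (partial i) g) f (enum 'I_d).

Definition mdegree (a : 'I_d -> nat) : nat := (\sum_(i < d) a i)%N.

End PartialDerivatives.

(* Functions on Omega have the type Omega -> R; integrals over Omega are taken
   over R^d after extension by zero. *)
Section FunctionsOnDomain.
Variables (R : realType) (d : nat) (Omega : set 'rV[R]_d).
Implicit Types f g u : Omega -> R.

Definition zext f : leb_space R d -> R := 'valL_0 f.

Definition L2 : set (Omega -> R) :=
  [set f | zext f \in Lfun (leb R d) 2%:E].

Definition l2ip f g : R := \int[leb R d]_x (zext f x * zext g x).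

Definition Lqnorm (q : \bar R) f : \bar R := ('N[leb R d]_q[EFin \o zext f])%E.

Definition ae_eq_on f g := ae_eq (leb R d) Omega (zext f) (zext g).

Definition sobolev_ext (tau : R) f : set ('rV[R]_d -> R) :=
  [set fe | sobolev tau fe /\ ae_eq (leb R d) Omega (zext f) fe].

Definition sobolev_norm_on (tau : R) f : \bar R :=
  ereal_inf [set sobolev_norm tau fe | fe in sobolev_ext tau f].

Definition test_function : set ('rV[R]_d -> R) :=
  [set psi | let S := closure [set x | psi x != 0] in
    [/\ forall n, Ck n psi, compact S & S `<=` Omega°]].

Definition locally_integrable f :=
  forall K, compact K -> K `<=` Omega° ->
    (leb R d).-integrable K (EFin \o zext f).

(* g is a representative of the weak derivative D^a u; by convention D^0 u = u. *)
Definition weak_derivative (a : 'I_d -> nat) u g :=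
  measurable_fun setT (zext g) /\
  if mdegree a == 0%N then ae_eq_on u g
  else [/\ locally_integrable u, locally_integrable g
    & forall psi, test_function psi ->
        \int[leb R d]_x (zext u x * mpartial a psi x) =
        (-1) ^+ mdegree a * \int[leb R d]_x (zext g x * psi x)].

(* All representatives of D^a u have the same norm; the infimum is +oo when
   there is none, i.e. when D^a u is not a function. *)
Definition wd_norm (q : \bar R) (a : 'I_d -> nat) u : \bar R :=
  ereal_inf [set Lqnorm q g | g in weak_derivative a u].

Definition wseminorm (m : nat) (q : \bar R) u : \bar R :=
  let D (a : {ffun 'I_d -> 'I_m.+1}) : 'I_d -> nat := fun i => a i in
  match q with
  | r%:E => ((\sum_(a | mdegree (D a) == m) wd_norm q (D a) u `^ r) `^ r^-1)%E
  | +oo%E => \big[maxe/0%E]_(a | mdegree (D a) == m) wd_norm q (D a) u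
  | -oo%E => 0%E
  end.

End FunctionsOnDomain.
Arguments wseminorm {R d Omega} m%_N q%_E u%_R.

Section RKHS.
Variables (R : realType) (T : choiceType) (k : T -> T -> R).

Definition positive_definite :=
  (forall x y, k x y = k y x) /\
  forall n (x : 'I_n -> T) (c : 'I_n -> R),
    0 <= \sum_(i < n) \sum_(j < n) c i * c j * k (x i) (x j).

Variables (H : set (T -> R)) (ip : (T -> R) -> (T -> R) -> R).

Definition hnorm (f : T -> R) : R := Num.sqrt (ip f f).

Record is_rkhs : Prop := IsRKHS {
  rkhs0 : H 0;
  rkhs_lin : forall a f g, H f -> H g -> H (a *: f + g);
  rkhs_sym : forall f g, H f -> H g -> ip f g = ip g f;
  rkhs_ip_lin : forall a f g h, H f -> H g -> H h ->
    ip (a *: f + g) h = a * ip f h + ip g h;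
  rkhs_ge0 : forall f, H f -> 0 <= ip f f;
  rkhs_eq0 : forall f, H f -> ip f f = 0 -> f = 0;
  rkhs_complete : forall u : nat -> T -> R, (forall n, H (u n)) ->
    (forall e, 0 < e -> exists N, forall i j, (N <= i)%N -> (N <= j)%N ->
       hnorm (u i - u j) < e) ->
    exists2 f, H f & hnorm (u n - f) @[n --> \oo] --> (0 : R);
  rkhs_kernel : forall x, H (k^~ x);
  rkhs_reproducing : forall f x, H f -> ip f (k^~ x) = f x
}.

Record orthonormal_basis (psi : nat -> T -> R) : Prop := OrthonormalBasis {
  onb_mem : forall j, H (psi j);
  onb_orthonormal : forall i j, ip (psi i) (psi j) = (i == j)%:R;
  onb_expansion : forall f, H f ->
    hnorm (f - \sum_(j < n) ip f (psi j) *: psi j) @[n --> \oo] --> (0 : R)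
}.

Definition kernel_span (X : set T) : set (T -> R) :=
  [set s | exists c : T -> R, s = \sum_(x \in X) c x *: k^~ x].

(* In an RKHS, for finite X and f in H, there is exactly one such s, namely the
   orthogonal projection of f onto the span. *)
Definition interp (X : set T) (f : T -> R) : T -> R :=
  xget 0 [set s | kernel_span X s /\ forall x, X x -> s x = f x].

End RKHS.

Section KernelInterpolation.
Variables (R : realType) (d : nat) (Omega : set 'rV[R]_d).
Variables (k : Omega -> Omega -> R).
Variables (H : set (Omega -> R)) (ip : (Omega -> R) -> (Omega -> R) -> R).

(* H(Omega) consists of functions and H^tau(Omega) of almost-everywhere classes:
   passing to the class maps the former onto the latter, with equivalent norms
   (so that this map is also injective). *)
Record sobolev_kernel (tau : R) : Prop := SobolevKernel {
  sobolev_kernel_order : d%:R / 2 < tau;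
  sobolev_kernel_sub : forall f, H f -> sobolev_ext tau f !=set0;
  sobolev_kernel_sup : forall fe, sobolev tau fe ->
    exists2 f, H f & ae_eq (leb R d) Omega (zext f) fe;
  sobolev_kernel_equiv : exists c C : R, [/\ 0 < c, 0 < C & forall f, H f ->
    (c%:E * sobolev_norm_on tau f <= (hnorm ip f)%:E)%E /\
    ((hnorm ip f)%:E <= C%:E * sobolev_norm_on tau f)%E]
}.

Definition integral_operator (f : Omega -> R) : Omega -> R :=
  fun x => \int[leb R d]_y zext (fun y => k x y * f y) y.

Record mercer (lam : nat -> R) (phi : nat -> Omega -> R) : Prop := Mercer {
  mercer_operator : forall f, L2 f ->
    (forall x, (leb R d).-integrable setT
                 (EFin \o zext (fun y => k x y * f y))) /\
    L2 (integral_operator f);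
  mercer_L2 : forall j, L2 (phi j);
  mercer_orthonormal : forall i j, l2ip (phi i) (phi j) = (i == j)%:R;
  mercer_gt0 : forall j, 0 < lam j;
  mercer_eigen : forall j,
    ae_eq_on (integral_operator (phi j)) (lam j *: phi j);
  mercer_basis :
    orthonormal_basis H ip (fun j => Num.sqrt (lam j) *: phi j);
  mercer_expansion : forall f, L2 f ->
    Lqnorm 2%:E (f - \sum_(j < n) l2ip f (phi j) *: phi j)
      @[n --> \oo] --> 0%E
}.

Definition power_norm (lam : nat -> R) (phi : nat -> Omega -> R) (theta : R)
    (f : Omega -> R) : \bar R :=
  ((\sum_(j <oo) (lam j `^ (- theta) * l2ip f (phi j) ^+ 2)%:E) `^ 2^-1)%E.

Definition power_space (lam : nat -> R) (phi : nat -> Omega -> R) (theta : R) :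
    set (Omega -> R) :=
  [set f | [/\ L2 f,
      Lqnorm 2%:E (f - \sum_(j < n) l2ip f (phi j) *: phi j)
        @[n --> \oo] --> 0%E
    & (power_norm lam phi theta f < +oo)%E]].

(* Infinite when X is empty and Omega is not. *)
Definition fill_distance (X : set Omega) : \bar R :=
  ereal_sup [set ereal_inf [set (enorm (set_val x - set_val y))%:E | y in X]
            | x in [set: Omega]].

Definition interpolation_bound (tau : R) (m : nat) (q : \bar R) (C h0 : R) :=
  [/\ 0 < C, 0 < h0 & forall X, finite_set X ->
    (fill_distance X <= h0%:E)%E -> forall f, H f ->
    (wseminorm m q (f - interp k X f)
      <= (C * fine (fill_distance X) `^
                (tau - m%:R - d%:R * Num.max 0 (2^-1 - fine (q^-1)%E))
            * hnorm ip (f - interp k X f))%:E)%E].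

(* For theta >= 1 each class v in the power space has one representative w in H,
   the one at which point values, hence the interpolant, are taken. *)
Definition representative (v w : Omega -> R) := H w /\ ae_eq_on w v.

End KernelInterpolation.

(* Main.v *)
Require Import Defs.
From mathcomp Require Import all_boot all_order all_algebra finmap.
From mathcomp Require Import all_classical all_reals all_analysis.
From mathcomp Require Import measurable_realfun ring lra.

Set Implicit Arguments.
Unset Strict Implicit.
Unset Printing Implicit Defensive.
Import Order.TTheory GRing.Theory Num.Theory.
Import numFieldNormedType.Exports.
Local Open Scope classical_set_scope.
Local Open Scope ring_scope.

(** Write [e = w - I_X w].  Since [I_X] is the orthogonal projection onto the
    kernel span, [|e|_H^2 = <w, e>_H], and by Parseval this is the sum of
    [w_j e_j / lam_j] over the Mercer coefficients, hence at most
    [|w|_(1+theta) |e|_(1-theta)].  The interpolation inequality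
    [|e|_(1-theta) <= |e|_(L_2)^theta |e|_H^(1-theta)] and the error bound
    [|e|_(L_2) <= C_(0,2) h^tau |e|_H] leave
    [(C_(0,2) h^tau)^theta |w|_(1+theta)] after division by [|e|_H].

    That [H] embeds continuously into [L_2] (which yields
    [<f, phi_j>_(L_2) = lam_j^(1/2) <f, lam_j^(1/2) phi_j>_H] and bounded
    eigenvalues) is read off the same error bound for one fixed finite node set
    [X]: [f - I_X f] is controlled by the bound and [I_X] has finite rank.  This
    avoids Plancherel's theorem.  Bounded eigenvalues give
    [H_(1+theta) <= H_1 = H], hence the representative [w] of [v]. *)

(** * Semi-inner products *)

Section SemiInnerProduct.
Variables (R : realType) (T : choiceType).
Variables (V : set (T -> R)) (ip : (T -> R) -> (T -> R) -> R).

(** Definiteness is left out because the [L_2] pairing of functions, rather than classes, is only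
    semidefinite. The lemmas below then serve [L_2], [H] and finite sums alike. *)
Record semi_inner_product : Prop := SemiInnerProduct {
  sip0 : V 0;
  sip_lin : forall a f g, V f -> V g -> V (a *: f + g);
  sip_sym : forall f g, V f -> V g -> ip f g = ip g f;
  sip_ip_lin : forall a f g h, V f -> V g -> V h ->
    ip (a *: f + g) h = a * ip f h + ip g h;
  sip_ge0 : forall f, V f -> 0 <= ip f f
}.

Hypothesis HV : semi_inner_product.

Lemma sipD f g : V f -> V g -> V (f + g).
Proof. by move=> Vf Vg; rewrite -[f]scale1r; exact: (sip_lin HV). Qed.

Lemma sipZ a f : V f -> V (a *: f).
Proof.
by move=> Vf; rewrite -[_ *: _]addr0; apply: (sip_lin HV) => //; exact: sip0.
Qed.

Lemma sipB f g : V f -> V g -> V (f - g).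
Proof. by move=> Vf Vg; rewrite -scaleN1r; apply: sipD => //; exact: sipZ. Qed.

Lemma sip_sum (I : Type) (r : seq I) (c : I -> R) (e : I -> T -> R) :
  (forall i, V (e i)) -> V (\sum_(i <- r) c i *: e i).
Proof.
move=> Ve; elim/big_ind: _ => [|f g|i _]; first exact: sip0.
- exact: sipD.
- exact: sipZ.
Qed.

Lemma ipDl f g h : V f -> V g -> V h -> ip (f + g) h = ip f h + ip g h.
Proof.
by move=> Vf Vg Vh; rewrite -[f]scale1r (sip_ip_lin HV)// mul1r scale1r.
Qed.

Lemma ip0l h : V h -> ip 0 h = 0.
Proof.
move=> Vh; have V0 := sip0 HV.
by have /eqP := ipDl V0 V0 Vh; rewrite addr0 -subr_eq subrr => /eqP.
Qed.

Lemma ipZl a f h : V f -> V h -> ip (a *: f) h = a * ip f h.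
Proof.
move=> Vf Vh; have V0 := sip0 HV.
by rewrite -[a *: f]addr0 (sip_ip_lin HV)// ip0l// addr0.
Qed.

Lemma ipBl f g h : V f -> V g -> V h -> ip (f - g) h = ip f h - ip g h.
Proof.
move=> Vf Vg Vh; rewrite -scaleN1r ipDl ?ipZl ?mulN1r//; exact: sipZ.
Qed.

Lemma ipBr f g h : V f -> V g -> V h -> ip h (f - g) = ip h f - ip h g.
Proof.
by move=> Vf Vg Vh; have ? := sipB Vf Vg; rewrite !(sip_sym HV Vh)// ipBl.
Qed.

Lemma ipZr a f h : V f -> V h -> ip h (a *: f) = a * ip h f.
Proof.
by move=> Vf Vh; have ? := sipZ a Vf; rewrite !(sip_sym HV Vh)// ipZl.
Qed.

Lemma ip_suml (I : Type) (r : seq I) (c : I -> R) (e : I -> T -> R) h :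
  (forall i, V (e i)) -> V h ->
  ip (\sum_(i <- r) c i *: e i) h = \sum_(i <- r) c i * ip (e i) h.
Proof.
move=> Ve Vh; elim: r => [|i r IH]; first by rewrite !big_nil ip0l.
rewrite !big_cons ipDl ?IH ?ipZl//; [exact: sipZ | exact: sip_sum].
Qed.

(** The form [key] has two free coefficients, so that the case [ip g g = 0] is covered without
    dividing by it. *)
Lemma ip_cauchy_schwarz f g : V f -> V g -> ip f g ^+ 2 <= ip f f * ip g g.
Proof.
move=> Vf Vg; have Vaf a : V (a *: f) by exact: sipZ.
have Vag a : V (a *: g) by exact: sipZ.
have key a b : 0 <= a ^+ 2 * ip f f - 2 * a * b * ip f g + b ^+ 2 * ip g g.
  have Vd := sipB (Vaf a) (Vag b).
  have := sip_ge0 HV Vd; rewrite ipBl// !ipBr// !ipZl// !ipZr//.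
  rewrite (sip_sym HV Vg Vf); congr (_ <= _); ring.
have := sip_ge0 HV Vf; have := sip_ge0 HV Vg.
set a := ip f f in key *; set b := ip f g in key *; set c := ip g g in key *.
rewrite le_eqVlt => /predU1P[c0|c0].
  rewrite -c0 in key *.
  rewrite le_eqVlt => /predU1P[a0|a0].
    by rewrite -a0 in key *; have := key 1 b; nra.
  by have := key b a; rewrite mulr0 expr2; nra.
by have := key c b; move=> + _; rewrite !expr2; nra.
Qed.

Lemma hnorm_ge0 f : 0 <= hnorm ip f.
Proof. exact: sqrtr_ge0. Qed.

Lemma hnorm_sqr f : V f -> hnorm ip f ^+ 2 = ip f f.
Proof. by move=> Vf; rewrite sqr_sqrtr//; exact: sip_ge0. Qed.

Lemma ler_norm_ip f g : V f -> V g -> `|ip f g| <= hnorm ip f * hnorm ip g.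
Proof.
move=> Vf Vg; rewrite -ler_sqr ?nnegrE ?mulr_ge0 ?hnorm_ge0//.
by rewrite exprMn !hnorm_sqr// real_normK ?num_real// ip_cauchy_schwarz.
Qed.

Lemma hnormZ a f : V f -> hnorm ip (a *: f) = `|a| * hnorm ip f.
Proof.
move=> Vf; rewrite /hnorm ipZl ?ipZr//; last exact: sipZ.
by rewrite mulrA -expr2 sqrtrM ?sqr_ge0// sqrtr_sqr.
Qed.

Lemma ler_hnormD f g : V f -> V g ->
  hnorm ip (f + g) <= hnorm ip f + hnorm ip g.
Proof.
move=> Vf Vg; have Vs := sipD Vf Vg.
rewrite -ler_sqr ?nnegrE ?addr_ge0 ?hnorm_ge0// hnorm_sqr// ipDl//.
rewrite (sip_sym HV Vf)// (sip_sym HV Vg)// !ipDl// (sip_sym HV Vg Vf).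
rewrite sqrrD !hnorm_sqr//.
have := le_trans (ler_norm _) (ler_norm_ip Vf Vg); lra.
Qed.

Section Orthonormal.
Variable e : nat -> T -> R.
Hypotheses (Ve : forall j, V (e j))
           (eo : forall i j, ip (e i) (e j) = (i == j)%:R).

Lemma ip_partial_sum (c : nat -> R) n j :
  ip (\sum_(i < n) c i *: e i) (e j) = if (j < n)%N then c j else 0.
Proof.
rewrite (ip_suml _ (fun i : 'I_n => c i))//; under eq_bigr do rewrite eo.
case: ifPn => [jn|jn].
  rewrite (bigD1 (Ordinal jn))//= eqxx mulr1 big1 ?addr0// => i.
  by rewrite -val_eqE/= => /negbTE ->; rewrite mulr0.
rewrite big1// => i _; case: eqP => [ij|]; last by rewrite mulr0.
by rewrite -ij ltn_ord in jn.
Qed.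

Lemma hnorm_partial_sum (c : nat -> R) n :
  hnorm ip (\sum_(i < n) c i *: e i) ^+ 2 = \sum_(i < n) c i ^+ 2.
Proof.
have VS : V (\sum_(i < n) c i *: e i).
  exact: (sip_sum _ (fun i : 'I_n => c i)).
rewrite hnorm_sqr// (ip_suml _ (fun i : 'I_n => c i))//.
apply: eq_bigr => i _; rewrite (sip_sym HV)// ip_partial_sum ltn_ord.
by rewrite expr2.
Qed.

Lemma bessel f n : V f -> \sum_(j < n) ip f (e j) ^+ 2 <= ip f f.
Proof.
move=> Vf; set S := \sum_(i < n) ip f (e i) *: e i.
have VS : V S by exact: (sip_sum _ (fun i : 'I_n => ip f (e i))).
have SS : ip S S = \sum_(j < n) ip f (e j) ^+ 2.
  by rewrite -hnorm_sqr// (hnorm_partial_sum (fun j => ip f (e j))).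
have Sf : ip S f = \sum_(j < n) ip f (e j) ^+ 2.
  rewrite /S (ip_suml _ (fun i : 'I_n => ip f (e i)))//.
  by apply: eq_bigr => i _; rewrite (sip_sym HV)// -expr2.
have := sip_ge0 HV (sipB Vf VS); rewrite ipBl ?ipBr//; last exact: sipB.
rewrite (sip_sym HV Vf VS) Sf SS; lra.
Qed.

End Orthonormal.
End SemiInnerProduct.

(** * Inequalities for real numbers and limits of real sequences *)

Lemma cauchy_schwarz_sum (R : realType) n (f g : 'I_n -> R) :
  (\sum_i f i * g i) ^+ 2 <= (\sum_i f i ^+ 2) * (\sum_i g i ^+ 2).
Proof.
pose dot (f g : 'I_n -> R) := \sum_i f i * g i.
have D : semi_inner_product setT dot.
  split=> // [f1 g1 _ _|a f1 g1 h _ _ _|f1 _].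
  - by apply: eq_bigr => i _; rewrite mulrC.
  - rewrite /dot mulr_sumr -big_split/=; apply: eq_bigr => i _.
    by rewrite mulrA -mulrDl.
  - by apply: sumr_ge0 => i _; rewrite -expr2 sqr_ge0.
have sqrE h : \sum_i h i ^+ 2 = dot h h.
  by apply: eq_bigr => i _; rewrite expr2.
by rewrite !sqrE; exact: (ip_cauchy_schwarz D).
Qed.

(** Young's inequality for [t^theta] times [1] with exponents [1/theta] and [1/(1-theta)]; the
    right-hand side is the tangent at [t = 1] of a concave function. At the endpoints one exponent
    degenerates, so they are treated separately. *)
Lemma powR_le_affine (R : realType) (t theta : R) : 0 < t -> 0 <= theta <= 1 ->
  t `^ theta <= theta * t + (1 - theta).
Proof.
move=> t0 /andP[]; rewrite le_eqVlt => /predU1P[<- _|th0].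
  by rewrite powRr0 mul0r subr0 add0r.
rewrite le_eqVlt => /predU1P[->|th1].
  by rewrite subrr addr0 mul1r powRr1 ?(ltW t0).
have th1' : 0 < 1 - theta by rewrite subr_gt0.
have := @conjugate_powR R (t `^ theta) 1 theta^-1 (1 - theta)^-1.
rewrite -powRrM divff ?gt_eqF// powRr1 ?(ltW t0)// powR1 !invrK mulr1 mul1r.
rewrite (mulrC t); apply => //; rewrite ?powR_ge0 ?invr_gt0//; lra.
Qed.

Lemma cvg_le_cvg0 (R : realType) (u v : nat -> R) (l C : R) :
  (forall n, `|l - u n| <= C * v n) -> v n @[n --> \oo] --> (0 : R) ->
  u n @[n --> \oo] --> l.
Proof.
move=> uv v0; have Cv : C * v n @[n --> \oo] --> (0 : R).
  by rewrite -(mulr0 C); apply: cvgM => //; exact: cvg_cst.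
apply/cvgrPdist_le => e e0; near=> n; apply: le_trans (uv n) _.
apply: le_trans (ler_norm _) _; near: n; exact: cvgr0_norm_le Cv _ e0.
Unshelve. all: by end_near. Qed.

(** The bound is asked only from [N] on because the [j]-th coefficient of a partial sum is final
    once more than [j] terms are present. *)
Lemma eq_le_cvg0 (R : realType) (l c C : R) (v : nat -> R) (N : nat) :
  (forall n, (N <= n)%N -> `|l - c| <= C * v n) ->
  v n @[n --> \oo] --> (0 : R) -> l = c.
Proof.
move=> lc v0.
apply: (@cvg_unique _ _ (c @[n --> \oo])) => //; last exact: cvg_cst.
apply: (@cvg_le_cvg0 _ _ (fun n => v (n + N)%N) _ C) => [n|].
  by apply: lc; rewrite leq_addl.
by rewrite (cvg_shiftn N v).
Qed.

(** * Square-integrable functions on the domain *)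

Section ZeroExtension.
Variables (R : realType) (d : nat) (Omega : set 'rV[R]_d).
Implicit Types f g : Omega -> R.

Lemma zext_val f (x : Omega) : zext f (val x) = f x.
Proof. exact: (congr1 (@^~ x) (valLK 0 f)). Qed.

Lemma zext_out f (x : 'rV[R]_d) : ~ Omega x -> zext f x = 0.
Proof.
move=> nx; rewrite /zext /valL_ oinv_set_val/= insubN//.
by apply/negP => /set_mem.
Qed.

Lemma domain_cases (x : 'rV[R]_d) : (exists y : Omega, x = val y) \/ ~ Omega x.
Proof.
have [/mem_set Ox|] := pselect (Omega x); [left | by right].
by exists (SigSub Ox).
Qed.

Lemma zext_lin a f g : zext (a *: f + g) = a \*: zext f \+ zext g.
Proof.
apply/funext => x; transitivity (a * zext f x + zext g x) => //.
have [[y ->]|nOx] := domain_cases x; first by rewrite !zext_val.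
by rewrite !zext_out// mulr0 addr0.
Qed.

Lemma zext0 : zext (0 : Omega -> R) = cst 0.
Proof.
apply/funext => x.
by have [[y ->]|nOx] := domain_cases x; rewrite ?zext_val ?zext_out.
Qed.

(** Outside [Omega] both extensions are zero. *)
Lemma ae_eq_onP f g :
  ae_eq_on f g <-> {ae leb R d, forall x, zext f x = zext g x}.
Proof.
split; last by apply: filterS => x.
apply: filterS => x fg; have [/fg//|nOx] := pselect (Omega x).
by rewrite !zext_out.
Qed.

End ZeroExtension.

Lemma le_Lnorm2 d (T : measurableType d) (R : realType)
    (mu : {measure set T -> \bar R}) (f g : T -> R) :
  measurable_fun setT f -> measurable_fun setT g ->
  {ae mu, forall x, `|f x| <= `|g x|} ->
  ('N[mu]_2%:E[EFin \o f] <= 'N[mu]_2%:E[EFin \o g])%E.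
Proof.
move=> mf mg fg; rewrite unlock /Lnorm.
have mpow (h : T -> R) : measurable_fun setT h ->
    measurable_fun setT (EFin \o (fun x => `|h x| `^ 2)).
  move=> mh; apply/measurable_EFinP.
  apply: (@measurableT_comp _ _ _ _ _ _ (fun x : R => x `^ 2)) => //.
  exact: measurableT_comp.
apply: gt0_ler_poweR => //; rewrite ?in_itv/= ?leey ?integral_ge0//.
apply: ae_ge0_le_integral => //; [exact: mpow | exact: mpow |].
by apply: filterS fg => x fgx _; rewrite lee_fin ge0_ler_powR ?nnegrE.
Qed.

Section L2space.
Variables (R : realType) (d : nat) (Omega : set 'rV[R]_d).
Implicit Types f g : Omega -> R.

Local Notation mu := (leb R d).

Lemma L2_measurable f : L2 f -> measurable_fun setT (zext f).
Proof. by rewrite /L2/= inE => /andP[/[!inE]]. Qed.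

Lemma L2P f : measurable_fun setT (zext f) -> (Lqnorm 2%:E f < +oo)%E -> L2 f.
Proof. by move=> mf ff; rewrite /L2/= inE; apply/andP; split; rewrite inE. Qed.

Lemma L2_integrable f g : L2 f -> L2 g ->
  mu.-integrable setT (EFin \o (zext f \* zext g)).
Proof. by move=> f2 g2; apply/Lfun1_integrable; exact: Lfun2_mul_Lfun1. Qed.

Lemma L2_0 : L2 (0 : Omega -> R).
Proof.
apply: L2P; first by rewrite zext0.
by rewrite /Lqnorm zext0 (_ : _ \o _ = cst 0%E)// Lnorm0.
Qed.

Lemma L2_lin a f g : L2 f -> L2 g -> L2 (a *: f + g).
Proof.
move=> f2 g2; rewrite /L2/= zext_lin.
have p1 : (1 <= 2%:E :> \bar R)%E by rewrite lee_fin ler1n.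
exact: (rpredD (rpredZ a f2) g2).
Qed.

Lemma l2ip_sym f g : l2ip f g = l2ip g f.
Proof. by rewrite /l2ip; apply: eq_Rintegral => x _; rewrite mulrC. Qed.

Lemma l2ip_lin a f g h : L2 f -> L2 g -> L2 h ->
  l2ip (a *: f + g) h = a * l2ip f h + l2ip g h.
Proof.
move=> f2 g2 h2; rewrite /l2ip zext_lin.
rewrite -RintegralZl//; last exact: L2_integrable.
rewrite -RintegralD//; last 2 first.
- exact: (integrableZl _ _ (L2_integrable f2 h2)).
- exact: L2_integrable.
by apply: eq_Rintegral => x _ /=; rewrite mulrDl mulrA.
Qed.

Lemma l2ip_ge0 f : 0 <= l2ip f f.
Proof. by apply: Rintegral_ge0 => x _; rewrite -expr2 sqr_ge0. Qed.

Lemma L2_semi_inner_product :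
  semi_inner_product (@L2 R d Omega) (@l2ip R d Omega).
Proof.
split; [exact: L2_0 | exact: L2_lin | by move=> *; exact: l2ip_sym
  | exact: l2ip_lin | by move=> *; exact: l2ip_ge0].
Qed.

Lemma Lqnorm2E f : L2 f -> Lqnorm 2%:E f = (hnorm (@l2ip R d Omega) f)%:E.
Proof.
move=> f2; rewrite /Lqnorm unlock /Lnorm.
have -> : (\int[mu]_x (`|(EFin \o zext f) x| `^ 2) = (l2ip f f)%:E)%E.
  rewrite /l2ip /Rintegral fineK; last exact/integrable_fin_num/L2_integrable.
  apply: eq_integral => x _ /=.
  by rewrite -expr2 powR_mulrn// -normrX ger0_norm// sqr_ge0.
by rewrite /hnorm -powR12_sqrt ?l2ip_ge0.
Qed.

Lemma eq_Lqnorm2 f g : measurable_fun setT (zext f) ->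
  measurable_fun setT (zext g) -> ae_eq_on f g ->
  (Lqnorm 2%:E f = Lqnorm 2%:E g)%E.
Proof.
move=> mf mg /ae_eq_onP fg; apply/eqP; rewrite eq_le /Lqnorm.
by apply/andP; split; apply: le_Lnorm2 => //; apply: filterS fg => x ->.
Qed.

Lemma hnorm_l2ip_eq0 f : L2 f -> hnorm (@l2ip R d Omega) f = 0 ->
  ae_eq_on f 0.
Proof.
move=> f2 f0; apply/ae_eq_onP; rewrite zext0.
have mf : measurable_fun setT (EFin \o zext f).
  exact/measurable_EFinP/L2_measurable.
have := @Lnorm_eq0_eq0 _ _ _ mu _ 2%:E mf.
rewrite -[Lnorm _ _ _]/(Lqnorm 2%:E f) Lqnorm2E// f0 lte_fin => /(_ _ erefl).
by move=> /(_ (ltr0Sn _ _)); apply: filterS => x /(_ I) [].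
Qed.

Lemma eq_l2ipl f g h : L2 f -> L2 g -> L2 h -> ae_eq_on f g ->
  l2ip f h = l2ip g h.
Proof.
move=> f2 g2 h2 /ae_eq_onP fg; rewrite /l2ip /Rintegral; congr fine.
apply: ae_eq_integral => //.
- exact: measurable_int (L2_integrable f2 h2).
- exact: measurable_int (L2_integrable g2 h2).
- by apply: filterS fg => x fgx _; rewrite /= fgx.
Qed.

End L2space.

(** * Interpolation in a reproducing kernel Hilbert space *)

Section KernelInterpolant.
Variables (R : realType) (T : choiceType) (k : T -> T -> R).
Variables (H : set (T -> R)) (ip : (T -> R) -> (T -> R) -> R).
Hypothesis RK : is_rkhs k H ip.

Lemma rkhs_semi_inner_product : semi_inner_product H ip.
Proof.
split; [exact: rkhs0 RK | exact: rkhs_lin RK | exact: rkhs_sym RK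
  | exact: rkhs_ip_lin RK | exact: rkhs_ge0 RK].
Qed.
Let HH := rkhs_semi_inner_product.

(** Reproducing property and Cauchy-Schwarz; thus convergence in [H] implies pointwise
    convergence. *)
Lemma ler_norm_eval f x : H f -> `|f x| <= hnorm ip f * hnorm ip (k^~ x).
Proof.
move=> Hf; rewrite -(rkhs_reproducing RK x Hf).
by apply: (ler_norm_ip HH) => //; exact: (rkhs_kernel RK).
Qed.

(** A list in place of the set in [kernel_span] allows induction on the nodes. *)
Definition seq_span (s : seq T) : set (T -> R) :=
  [set g | exists c : T -> R, g = \sum_(x <- s) c x *: k^~ x].

Lemma kernel_span_seq (s : seq T) : uniq s ->
  kernel_span k [set` s] = seq_span s.
Proof.
move=> us; apply/seteqP; split=> g [c ->]; exists c; first exact/esym/fsbig_seq.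
exact: fsbig_seq.
Qed.

Lemma seq_span_sub s : seq_span s `<=` H.
Proof.
move=> _ [c ->]; apply: (@sip_sum _ _ _ _ HH _ s c (fun x => k^~ x)) => x.
exact: (rkhs_kernel RK).
Qed.

Lemma seq_span_lin s a f g :
  seq_span s f -> seq_span s g -> seq_span s (a *: f + g).
Proof.
move=> [c ->] [c' ->]; exists (fun x => a * c x + c' x).
rewrite scaler_sumr -big_split/=; apply: eq_bigr => x _.
by rewrite scalerDl scalerA.
Qed.

Lemma seq_span_cons x s : x \notin s -> seq_span s `<=` seq_span (x :: s).
Proof.
move=> xs _ [c ->]; exists (fun y => if y == x then 0 else c y).
rewrite big_cons eqxx scale0r add0r; apply: eq_big_seq => y ys.
by case: eqP => // yx; rewrite -yx ys in xs.
Qed.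

Lemma seq_span_kernel x s : x \notin s -> seq_span (x :: s) (k^~ x).
Proof.
move=> xs; exists (fun y => (y == x)%:R).
rewrite big_cons eqxx scale1r big_seq big1 ?addr0// => y ys.
by case: eqP => [yx|]; [rewrite -yx ys in xs | rewrite scale0r].
Qed.

(** The reproducing property turns [ip h (k^~ x)] into [h x], which is zero at every node. *)
Lemma ip_seq_span s h g : H h -> {in s, h =1 cst 0} -> seq_span s g ->
  ip h g = 0.
Proof.
move=> Hh h0 sg; have Hg := seq_span_sub sg; move: sg => [c gE].
have Hk x : H (k^~ x) by exact: (rkhs_kernel RK).
rewrite (rkhs_sym RK)// gE (@ip_suml _ _ _ _ HH _ s c (fun x => k^~ x))//.
rewrite big_seq big1// => x xs.
rewrite (rkhs_sym RK)//.
by rewrite (rkhs_reproducing RK)// h0// mulr0.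
Qed.

(** Such a [g] lies in the span and is orthogonal to it. Interpolants are therefore unique even when
    the kernel matrix is singular. *)
Lemma seq_span_eq0 s g : seq_span s g -> {in s, g =1 cst 0} -> g = 0.
Proof.
move=> sg g0; have Hg := seq_span_sub sg.
by apply: (rkhs_eq0 RK) => //; exact: ip_seq_span sg.
Qed.

Lemma sub_eq0_in (s : seq T) (f g : T -> R) :
  {in s, g =1 f} -> {in s, f - g =1 cst 0}.
Proof. by move=> gf x xs; rewrite -[LHS]/(f x - g x) gf// subrr. Qed.

Lemma ip_residual s f g : H f -> seq_span s g -> {in s, g =1 f} ->
  ip (f - g) g = 0.
Proof.
move=> Hf sg gf; apply: ip_seq_span (sg).
- by apply: (sipB HH) => //; exact: seq_span_sub sg.
- exact: sub_eq0_in.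
Qed.

(** Pythagoras, as [f - g] and [g] are orthogonal. *)
Lemma ler_hnorm_residual s f g : H f -> seq_span s g -> {in s, g =1 f} ->
  hnorm ip (f - g) <= hnorm ip f.
Proof.
move=> Hf sg gf; have Hg := seq_span_sub sg.
have Hd : H (f - g) by exact: (sipB HH).
have gg0 := rkhs_ge0 RK Hg; have := ip_residual Hf sg gf.
rewrite -ler_sqr ?nnegrE ?hnorm_ge0// !(hnorm_sqr HH)//.
rewrite !(ipBl HH)// !(ipBr HH)// (rkhs_sym RK Hg Hf); lra.
Qed.

Variables (V : set (T -> R)) (ip2 : (T -> R) -> (T -> R) -> R).
Hypotheses (VV : semi_inner_product V ip2) (Vk : forall x, V (k^~ x)).

Lemma seq_span_subV s : seq_span s `<=` V.
Proof.
move=> _ [c ->]; exact: (@sip_sum _ _ _ _ VV _ s c (fun x => k^~ x)).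
Qed.

(* Induction on the nodes (Newton form): [g] is the residual of the kernel at
   the new node [x], and [g x = 0] forces [g = 0] since [g x = ip g g]. *)
Lemma interpolant_exists s : uniq s -> exists2 K : R, 0 <= K &
  forall f, H f -> exists g, [/\ seq_span s g, {in s, g =1 f} &
    hnorm ip2 g <= K * hnorm ip f].
Proof.
elim: s => [_|x s IH /= /andP[xs us]].
  exists 0 => // f Hf; exists 0; split=> //; first by exists 0; rewrite big_nil.
  by rewrite mul0r /hnorm (ip0l VV) ?sqrtr0//; exact: sip0 VV.
have [K K0 KP] := IH us.
have Hk := rkhs_kernel RK x.
have [J [sJ Jk _]] := KP _ Hk; have HJ := seq_span_sub sJ.
pose g := k^~ x - J; have Hg : H g by exact: (sipB HH).
have g0 : {in s, g =1 cst 0}.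
  exact: sub_eq0_in.
have ipgx h : H h -> {in s, h =1 cst 0} -> ip h (k^~ x) = ip h g.
  by move=> Hh h0; rewrite (ipBr HH)// (ip_seq_span Hh h0 sJ) subr0.
have [gx|gx] := eqVneq (g x) 0.
  have gE : g = 0.
    by apply: (rkhs_eq0 RK) => //; rewrite -ipgx// (rkhs_reproducing RK).
  (* Now [k^~ x = J] lies in the old span. The residual [f - h] is orthogonal to it, so [h] already
     interpolates at [x]. *)
  exists K => // f Hf; have [h [sh hf hK]] := KP f Hf.
  exists h; split=> //; first exact: seq_span_cons sh.
  move=> y; rewrite inE => /predU1P[->|]; last exact: hf.
  have Hh := seq_span_sub sh.
  have Hd : H (f - h) by exact: (sipB HH).
  have d0 : {in s, f - h =1 cst 0} by exact: sub_eq0_in.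
  have := ipgx _ Hd d0; rewrite gE (rkhs_reproducing RK)// (rkhs_sym RK)//.
    by rewrite (ip0l HH)// fctE => /eqP; rewrite subr_eq0 => /eqP.
  exact: rkhs0 RK.
(* Bounds the correction [a *: g] below: the numerator of [a] is the value at [x] of [f - h], whose
   [H]-norm is at most that of [f]. *)
pose N := hnorm ip (k^~ x) * `|(g x)^-1| * hnorm ip2 g.
have N0 : 0 <= N by rewrite !mulr_ge0 ?hnorm_ge0.
exists (K + N) => [|f Hf]; first exact: addr_ge0.
have [h [sh hf hK]] := KP f Hf; have Hh := seq_span_sub sh.
have Hd : H (f - h) by exact: (sipB HH).
pose a := (f x - h x) / g x.
have sg : seq_span (x :: s) g.
  rewrite /g -scaleN1r addrC.
  apply: seq_span_lin; first exact: seq_span_cons sJ.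
  exact: seq_span_kernel.
exists (a *: g + h); split.
- by apply: seq_span_lin => //; exact: seq_span_cons sh.
- move=> y; rewrite inE => /predU1P[->|ys].
    by transitivity (a * g x + h x) => //; rewrite /a divfK// subrK.
  by transitivity (a * g y + h y) => //; rewrite g0//= mulr0 add0r hf.
- have Vg := seq_span_subV sg; have Vh := seq_span_subV sh.
  apply: le_trans (ler_hnormD VV _ Vh) _; first exact: (sipZ VV).
  rewrite (hnormZ VV)// addrC mulrDl lerD//.
  have -> : N * hnorm ip f =
      hnorm ip f * hnorm ip (k^~ x) * `|(g x)^-1| * hnorm ip2 g.
    by rewrite /N; ring.
  rewrite /a normrM ler_wpM2r ?hnorm_ge0// ler_wpM2r//.
  apply: le_trans (ler_norm_eval x Hd) _.
  rewrite ler_wpM2r ?hnorm_ge0//; exact: ler_hnorm_residual sh hf.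
Qed.

(** [ip2] will be the [L_2] pairing, in which an operator of finite rank is bounded too. [K] depends
    on [X] but not on [f]. *)
Lemma interp_bounded (X : set T) : finite_set X -> exists2 K : R, 0 <= K &
  forall f, H f -> [/\ H (interp k X f), V (interp k X f),
    ip (f - interp k X f) (interp k X f) = 0,
    hnorm ip (f - interp k X f) <= hnorm ip f &
    hnorm ip2 (interp k X f) <= K * hnorm ip f].
Proof.
move=> /finite_seqP[s0 ->{X}]; pose s := undup s0.
have us : uniq s by exact: undup_uniq.
have -> : [set` s0] = [set` s] by apply/seteqP; split=> x/=; rewrite mem_undup.
have [K K0 KP] := interpolant_exists us; exists K => // f Hf.
have [g [sg gf gK]] := KP f Hf.
(* Uniqueness excludes that [xget] picks another interpolant, existence that it falls back on
   [0]. *)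
have -> : interp k [set` s] f = g.
  rewrite /interp; case: xgetP => [h _ []|/(_ g)]; rewrite kernel_span_seq//.
    move=> sh hf; apply/eqP; rewrite -subr_eq0; apply/eqP.
    apply: (@seq_span_eq0 s); last first.
      by apply: sub_eq0_in => x xs; rewrite gf// hf.
    by rewrite -scaleN1r addrC; exact: seq_span_lin.
  by case; split.
split=> //; [exact: seq_span_sub sg | exact: seq_span_subV sg
  | exact: ip_residual sg gf | exact: ler_hnorm_residual sg gf].
Qed.

End KernelInterpolant.

(** The squared distances of the partial sums [u] are the distances of the [p n], which are
    nondecreasing and bounded; so [u] is Cauchy, and its limit keeps the coefficients. *)
Lemma riesz_fischer (R : realType) (T : choiceType) (k : T -> T -> R)
    (H : set (T -> R)) (ip : (T -> R) -> (T -> R) -> R)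
    (e : nat -> T -> R) (c : nat -> R) (B : R) :
  is_rkhs k H ip -> (forall j, H (e j)) ->
  (forall i j, ip (e i) (e j) = (i == j)%:R) ->
  (forall n, \sum_(j < n) c j ^+ 2 <= B) ->
  exists2 w, H w & forall j, ip w (e j) = c j.
Proof.
move=> RK He eo cB; have HH := rkhs_semi_inner_product RK.
pose u n := \sum_(j < n) c j *: e j; pose p n := \sum_(j < n) c j ^+ 2.
have Hu n : H (u n) by exact: (sip_sum HH _ (fun i : 'I_n => c i)).
have p_mono i j : (i <= j)%N -> p i <= p j.
  move=> ij; rewrite /p -(subnKC ij) big_split_ord/= lerDl.
  by apply: sumr_ge0 => l _; exact: sqr_ge0.
have uij i j : (i <= j)%N -> ip (u i) (u j) = p i.
  move=> ij; rewrite (ip_suml HH _ (fun l : 'I_i => c l))//.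
  apply: eq_bigr => l _; rewrite (rkhs_sym RK)// (ip_partial_sum HH He eo).
  by rewrite (leq_trans (ltn_ord l) ij) expr2.
have dist i j : hnorm ip (u i - u j) ^+ 2 = `|p i - p j|.
  rewrite (hnorm_sqr HH); last exact: (sipB HH).
  rewrite !(ipBl HH)// ?(ipBr HH)//; try exact: (sipB HH).
  rewrite (uij i i)// (uij j j)//; have [ij|/ltnW ij] := leqP i j.
    rewrite (rkhs_sym RK (Hu j))// (uij i j)//.
    rewrite ler0_norm ?subr_le0 ?p_mono//; ring.
  rewrite (rkhs_sym RK (Hu i))// (uij j i)//.
  rewrite ger0_norm ?subr_ge0 ?p_mono//; ring.
have p_cvg : cvgn p.
  apply: nondecreasing_is_cvgn => //; exists B => _ [n _ <-]; exact: cB.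
have [eps eps0|w Hw uw] := rkhs_complete RK Hu.
  (* [dist] is about squared norms, hence [eps ^+ 2]; one half goes to each of [i] and [j]. *)
  have e20 : 0 < eps ^+ 2 / 2 by rewrite divr_gt0 ?exprn_gt0.
  have /cvgrPdist_lt/(_ _ e20)[N _ NP] := p_cvg.
  exists N => i j Ni Nj; rewrite -ltr_sqr ?nnegrE ?hnorm_ge0 ?ltW// dist.
  rewrite [ltRHS]splitr -(subrKA (limn p)).
  apply: le_lt_trans (ler_normD _ _) _; rewrite ltrD//; last exact: NP.
  by rewrite distrC; exact: NP.
exists w => // j; apply: (@eq_le_cvg0 _ _ _ 1 _ j.+1 _ uw) => n jn.
have <- : ip (u n) (e j) = c j by rewrite (ip_partial_sum HH He eo) jn.
have Hd : H (u n - w) by exact: (sipB HH).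
rewrite distrC -(ipBl HH)// mul1r -[leRHS]mulr1.
have <- : hnorm ip (e j) = 1 by rewrite /hnorm eo eqxx sqrtr1.
exact: (ler_norm_ip HH).
Qed.

(** * The embedding into L_2 *)

(** Compares the Euclidean norm of the fill distance with the maximum norm that defines balls. *)
Lemma le_enorm (R : realType) (d : nat) (x : 'rV[R]_d) :
  enorm x <= Num.sqrt d%:R * `|x|.
Proof.
rewrite -[leRHS]ger0_norm ?mulr_ge0// -sqrtr_sqr ler_wsqrtr//.
rewrite exprMn sqr_sqrtr// /dotv mulr_natl.
have xi i : x ord0 i * x ord0 i <= `|x| ^+ 2.
  rewrite -expr2 -real_normK ?num_real// ler_sqr ?nnegrE//.
  rewrite [leRHS]/Num.norm/= mx_normrE; apply/bigmax_geP; right => /=.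
  by exists (ord0, i).
by apply: le_trans (ler_sum _ (fun i _ => xi i)) _; rewrite sumr_const card_ord.
Qed.

Lemma exists_fill_distance_le (R : realType) (d : nat) (Omega : set 'rV[R]_d)
    (h : R) : bounded_set Omega -> 0 < h ->
  exists2 X : set Omega, finite_set X & (fill_distance X <= h%:E)%E.
Proof.
move=> [M [_ OM]] h0.
(* Chosen so that [Num.sqrt d%:R * e <= h]; the [+ 1] keeps the divisor positive for [d = 0]. *)
pose e := h / (Num.sqrt d%:R + 1).
have s0 : 0 < Num.sqrt d%:R + 1 :> R by rewrite ltr_wpDl ?sqrtr_ge0.
have e0 : 0 < e by rewrite divr_gt0.
(* Boundedness gives a bound only for radii strictly above [M], hence [M + 1]. *)
pose B := [set x : 'rV[R]_d | `|x| <= M + 1].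
have clB : closed B.
  rewrite (_ : B = (Num.norm : 'rV[R]_d -> R) @^-1` [set r | r <= M + 1])//.
  apply: preimage_closed => [x _|]; last exact: closed_le.
  exact: norm_continuous.
have cpB : compact B.
  apply: bounded_closed_compact => //.
  exists (M + 1); split; first exact: num_real.
  by move=> r Mr x /le_trans; apply; exact: ltW.
have cO : compact (closure Omega).
  apply: subclosed_compact (cpB) _; first exact: closed_closure.
  rewrite [X in _ `<=` X](closure_id _).1//; apply: closure_subset => x Ox.
  by apply: OM Ox; rewrite ltrDl.
(* The balls are centred in [Omega] itself, so the centres of a finite subcover can serve as
   nodes. *)
move: cO; rewrite compact_cover => /(_ _ Omega (fun p => ball p e)).
case=> [p _|x|D DO cD].
- exact: ball_open.
- move=> /(_ _ (nbhsx_ballx x e e0)) [p [Op xp]].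
  by exists p => //; exact: ball_sym.
exists [set x : Omega | val x \in D].
  apply: (finite_preimage _ (finite_fset D)) => x y _ _; exact: val_inj.
apply: ub_ereal_sup => _ [x _ <-].
have /cD[p /= pD xp] : closure Omega (val x).
  by apply: subset_closure; exact/set_mem/valP.
apply: ereal_inf_le; exists (enorm (val x - p))%:E.
  by exists (SigSub (DO _ pD)).
rewrite lee_fin; apply: le_trans (le_enorm _) _.
move: xp; rewrite -ball_normE/= distrC => /ltW xp.
apply: le_trans (ler_wpM2l _ xp) _; first exact: sqrtr_ge0.
by rewrite /e mulrA ler_pdivrMr// mulrDr mulr1 mulrC lerDl ltW.
Qed.

Section WeakSeminorm.
Variables (R : realType) (d : nat) (Omega : set 'rV[R]_d).
Implicit Types u : Omega -> R.

(** At order zero the representatives are the functions a.e. equal to [u], all of the same norm. *)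
Lemma wd_norm0 (a : 'I_d -> nat) u : mdegree a = 0%N ->
  measurable_fun setT (zext u) -> wd_norm 2%:E a u = Lqnorm 2%:E u.
Proof.
move=> a0 mu; have uu : weak_derivative a u u.
  by split=> //; rewrite a0 eqxx; apply/ae_eq_onP; exact: nearW.
apply/eqP; rewrite eq_le; apply/andP; split.
  by apply: ereal_inf_lbound; exists u.
apply: le_ereal_inf_tmp => x [g [mg ug] <-{x}]; rewrite a0 eqxx in ug.
by rewrite (eq_Lqnorm2 mu mg ug).
Qed.

(** The zero multi-index is the only summand. This turns the error bound for the pair [(0,2)] into
    an [L_2] bound. *)
Lemma wseminorm0_2 u : measurable_fun setT (zext u) ->
  wseminorm 0 2%:E u = Lqnorm 2%:E u.
Proof.
move=> mu; rewrite /wseminorm.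
have D0 (a : {ffun 'I_d -> 'I_1}) : mdegree (fun i => a i : nat) = 0%N.
  by rewrite /mdegree big1// => i _; rewrite (ord1 (a i)).
rewrite (big_pred1 [ffun=> ord0]) => [|a]; last first.
  rewrite D0 eqxx; apply/esym/eqP/ffunP => i; rewrite ffunE; exact: ord1.
by rewrite wd_norm0// -poweRrM divff// poweRe1// Lnorm_ge0.
Qed.

End WeakSeminorm.

Section Embedding.
Variables (R : realType) (d : nat) (Omega : set 'rV[R]_d).
Variables (k : Omega -> Omega -> R).
Variables (H : set (Omega -> R)) (ip : (Omega -> R) -> (Omega -> R) -> R).
Variables (tau : R) (lam : nat -> R) (phi : nat -> Omega -> R).
Hypotheses (RK : is_rkhs k H ip) (SK : sobolev_kernel H ip tau).
Hypothesis ME : mercer k H ip lam phi.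

Let HH := rkhs_semi_inner_product RK.
Let LL := L2_semi_inner_product Omega.
Let psi j : Omega -> R := Num.sqrt (lam j) *: phi j.
Local Notation l2 := (hnorm (@l2ip R d Omega)).

Let Hpsi j : H (psi j).
Proof. exact: (onb_mem (mercer_basis ME)). Qed.

Let psi_o i j : ip (psi i) (psi j) = (i == j)%:R.
Proof. exact: (onb_orthonormal (mercer_basis ME)). Qed.

Let L2psi j : L2 (psi j).
Proof. exact: (sipZ LL _ (mercer_L2 ME j)). Qed.

Let S f n := \sum_(j < n) ip f (psi j) *: psi j.

Let HS f n : H (S f n).
Proof. exact: (sip_sum HH _ (fun i : 'I_n => ip f (psi i))). Qed.

Let L2S f n : L2 (S f n).
Proof. exact: (sip_sum LL _ (fun i : 'I_n => ip f (psi i))). Qed.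

(** The Mercer partial sums are measurable and converge pointwise, since evaluation is continuous on
    [H]. *)
Lemma rkhs_measurable f : H f -> measurable_fun setT (zext f).
Proof.
move=> Hf; apply: (@measurable_fun_cvg _ _ _ _ (fun n => zext (S f n))).
  by move=> n; exact: L2_measurable.
move=> x _; have [[y ->]|nOx] := domain_cases Omega x; last first.
  by rewrite zext_out//; under eq_cvg do rewrite zext_out//; exact: cvg_cst.
rewrite zext_val; under eq_cvg do rewrite zext_val.
apply: (@cvg_le_cvg0 _ _ (fun n => hnorm ip (f - S f n)) _ (hnorm ip (k^~ y))).
  by move=> n; rewrite mulrC; apply: (ler_norm_eval RK) => //; exact: (sipB HH).
exact: (onb_expansion (mercer_basis ME) Hf).
Qed.

(** A Sobolev extension lies in [L_2] and dominates the zero extension a.e.; no norm estimate is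
    obtained yet. *)
Lemma rkhs_sub_L2 f : H f -> L2 f.
Proof.
move=> Hf; have mf := rkhs_measurable Hf; apply: L2P => //.
have [fe [[fe2 _] ffe]] := sobolev_kernel_sub SK Hf.
have mfe := set_mem (sub_Lfun_mfun fe2).
have := set_mem (sub_Lfun_finLfun fe2); apply: le_lt_trans.
apply: le_Lnorm2 => //; apply: filterS ffe => x fx.
have [Ox|nOx] := pselect (Omega x); first by rewrite fx.
by rewrite zext_out// normr0.
Qed.

Lemma rkhs_embedding C h0 : bounded_set Omega ->
  interpolation_bound k H ip tau 0 2%:E C h0 ->
  exists K : R, forall f, H f -> l2 f <= K * hnorm ip f.
Proof.
move=> bO [C0 h00 IB].
have [X finX fX] := exists_fill_distance_le bO h00.
have Vk x : L2 (k^~ x) by apply: rkhs_sub_L2; exact: (rkhs_kernel RK).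
have [K K0 KP] := interp_bounded RK LL Vk finX.
(* With [X] fixed, [c] does not depend on [f]. *)
move: (IB _ finX fX); set c := C * _ => cP.
exists (c + K) => f Hf; have [HI LI _ fI IK] := KP f Hf.
have Hd : H (f - interp k X f) by exact: (sipB HH).
have Ld := rkhs_sub_L2 Hd.
have := cP f Hf; rewrite wseminorm0_2; last exact: rkhs_measurable.
rewrite Lqnorm2E// lee_fin => dc.
rewrite -[f in l2 f](subrK (interp k X f)).
apply: le_trans (ler_hnormD LL Ld LI) _.
rewrite mulrDl lerD// (le_trans dc)// ler_wpM2l//.
by rewrite mulr_ge0 ?powR_ge0// ltW.
Qed.

End Embedding.

(** * Power spaces *)

Section PowerSpace.
Variables (R : realType) (d : nat) (Omega : set 'rV[R]_d).
Variables (k : Omega -> Omega -> R).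
Variables (H : set (Omega -> R)) (ip : (Omega -> R) -> (Omega -> R) -> R).
Variables (lam : nat -> R) (phi : nat -> Omega -> R) (K : R).
Hypotheses (RK : is_rkhs k H ip) (ME : mercer k H ip lam phi).
Local Notation l2 := (hnorm (@l2ip R d Omega)).
Hypotheses (HL : forall f, H f -> L2 f)
           (EK : forall f, H f -> l2 f <= K * hnorm ip f).

Let HH := rkhs_semi_inner_product RK.
Let LL := L2_semi_inner_product Omega.
Let psi j : Omega -> R := Num.sqrt (lam j) *: phi j.
Let Hpsi j : H (psi j).
Proof. exact: (onb_mem (mercer_basis ME)). Qed.
Let psi_o i j : ip (psi i) (psi j) = (i == j)%:R.
Proof. exact: (onb_orthonormal (mercer_basis ME)). Qed.
Let Lphi := mercer_L2 ME.
Let phi_o := mercer_orthonormal ME.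
Let lam0 := mercer_gt0 ME.
Let S f n := \sum_(j < n) ip f (psi j) *: psi j.
Let HS f n : H (S f n).
Proof. exact: (sip_sum HH _ (fun i : 'I_n => ip f (psi i))). Qed.
Let S_cvg f : H f -> hnorm ip (f - S f n) @[n --> \oo] --> (0 : R).
Proof. exact: (onb_expansion (mercer_basis ME)). Qed.
Let sqrt_lam_gt0 j : 0 < Num.sqrt (lam j).
Proof. by rewrite sqrtr_gt0. Qed.

Lemma l2_phi j : l2 (phi j) = 1.
Proof. by rewrite /hnorm phi_o eqxx sqrtr1. Qed.

Lemma hnorm_psi j : hnorm ip (psi j) = 1.
Proof. by rewrite /hnorm psi_o eqxx sqrtr1. Qed.

(** Clear for the partial sums with [n > j]; by [EK] the [L_2] pairing passes to the limit in
    [H]. *)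
Lemma l2ip_phi f j : H f -> l2ip f (phi j) = Num.sqrt (lam j) * ip f (psi j).
Proof.
move=> Hf; apply: (@eq_le_cvg0 _ _ _ K _ j.+1 _ (S_cvg Hf)) => n jn.
have Hd : H (f - S f n) by exact: (sipB HH).
have <- : l2ip (S f n) (phi j) = Num.sqrt (lam j) * ip f (psi j).
  rewrite (_ : S f n =
      \sum_(i < n) (Num.sqrt (lam i) * ip f (psi i)) *: phi i); last first.
    by apply: eq_bigr => i _; rewrite /psi scalerA mulrC.
  by rewrite (ip_partial_sum LL Lphi phi_o
    (fun i => Num.sqrt (lam i) * ip f (psi i))) jn.
rewrite -(ipBl LL (HL Hf) (HL (HS f n)) (Lphi j)).
apply: le_trans (ler_norm_ip LL (HL Hd) (Lphi j)) _.
by rewrite l2_phi mulr1 EK.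
Qed.

(** [EK] is tested on [psi j], of norm [1] in [H] and [sqrt (lam j)] in [L_2]. *)
Lemma mercer_eigenvalue_le j : lam j <= K ^+ 2.
Proof.
have := EK (Hpsi j); rewrite hnorm_psi mulr1 (hnormZ LL)//.
rewrite l2_phi mulr1 ger0_norm ?sqrtr_ge0// => sK.
rewrite -[lam j]sqr_sqrtr ?(ltW (lam0 j))// ler_sqr// nnegrE ?sqrtr_ge0//.
exact: le_trans sK.
Qed.

Lemma parseval f g : H f -> H g ->
  \sum_(j < n) ip f (psi j) * ip g (psi j) @[n --> \oo] --> ip f g.
Proof.
move=> Hf Hg; apply: (@cvg_le_cvg0 _ _ _ _ (hnorm ip g) _ (S_cvg Hf)) => n.
have Hd : H (f - S f n) by exact: (sipB HH).
have <- : ip (S f n) g = \sum_(j < n) ip f (psi j) * ip g (psi j).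
  rewrite (ip_suml HH _ (fun i : 'I_n => ip f (psi i)))//.
  by apply: eq_bigr => i _; rewrite (rkhs_sym RK Hg).
rewrite -(ipBl HH)// mulrC; exact: (ler_norm_ip HH).
Qed.

Lemma rkhs_eq0_l2ip f : H f -> (forall j, l2ip f (phi j) = 0) -> f = 0.
Proof.
move=> Hf f0; apply: (rkhs_eq0 RK) => //.
apply: (@cvg_unique _ _ (0 @[n --> \oo])) => //; last exact: cvg_cst.
apply: cvg_trans (parseval Hf Hf); apply: near_eq_cvg; apply: nearW => n.
rewrite big1// => j _; have /eqP := f0 j.
by rewrite l2ip_phi// mulf_eq0 gt_eqF//= => /eqP ->; rewrite mul0r.
Qed.

Lemma L2_eq0_l2ip f : L2 f -> (forall j, l2ip f (phi j) = 0) -> ae_eq_on f 0.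
Proof.
move=> f2 f0; apply: hnorm_l2ip_eq0 => //.
have l20 : (l2 f)%:E @[_ --> \oo] --> 0%E.
  apply: cvg_trans (mercer_expansion ME f2).
  apply: near_eq_cvg; apply: nearW => n.
  by rewrite big1 ?subr0 ?Lqnorm2E// => j _; rewrite f0 scale0r.
apply: EFin_inj; rewrite -[RHS](cvg_lim (@ereal_hausdorff R) l20).
by rewrite (lim_cst (@ereal_hausdorff R)).
Qed.

Section PowerBound.
Variables (theta M : R).
Hypotheses (th01 : 0 <= theta <= 1) (M0 : 0 <= M).

(** Passing from [L_2] to [H] coefficients shifts the order of the power norm by one. *)
Lemma power_weight a j :
  lam j `^ (- (1 + theta)) * (Num.sqrt (lam j) * a) ^+ 2
  = lam j `^ (- theta) * a ^+ 2.
Proof.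
rewrite exprMn sqr_sqrtr ?(ltW (lam0 j))// mulrA opprD addrC powRD; last first.
  by rewrite (gt_eqF (lam0 j)) implybT.
by rewrite powR_inv1 ?(ltW (lam0 j))// divfK// gt_eqF.
Qed.

(* The interpolation inequality [|e|_(1-theta) <= |e|_0^theta |e|_1^(1-theta)]
   for the dual power norm, in the form of the affine bound on
   [(lam j / B^2)^theta]. *)
Lemma power_weight_bound e B n : H e -> 0 < B -> l2 e <= B * hnorm ip e ->
  \sum_(j < n) lam j `^ theta * ip e (psi j) ^+ 2
    <= (B `^ theta * hnorm ip e) ^+ 2.
Proof.
move=> He B0 eB; have Le := HL He; have B20 : 0 < B ^+ 2 by rewrite exprn_gt0.
(* The two endpoints of the interpolation: Bessel's inequality in [H] for [theta = 0], and in [L_2]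
   together with [eB] for [theta = 1]. *)
have y1 : \sum_(j < n) ip e (psi j) ^+ 2 <= hnorm ip e ^+ 2.
  by rewrite (hnorm_sqr HH)//; exact: (bessel HH).
have y0 : \sum_(j < n) lam j * ip e (psi j) ^+ 2 <= B ^+ 2 * hnorm ip e ^+ 2.
  have -> : \sum_(j < n) lam j * ip e (psi j) ^+ 2
          = \sum_(j < n) l2ip e (phi j) ^+ 2.
    by apply: eq_bigr => j _; rewrite l2ip_phi// exprMn sqr_sqrtr// ltW.
  apply: le_trans (bessel LL Lphi phi_o n Le) _.
  rewrite -(hnorm_sqr LL)// -exprMn ler_sqr ?nnegrE ?hnorm_ge0//.
  by rewrite mulr_ge0 ?hnorm_ge0// ltW.
have [th0 th1] := andP th01.
have lamB j : lam j `^ theta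
    <= (B ^+ 2) `^ theta * (theta * (lam j / B ^+ 2) + (1 - theta)).
  have t0 : 0 < lam j / B ^+ 2 by rewrite divr_gt0.
  apply: le_trans (ler_wpM2l (powR_ge0 _ _) (powR_le_affine t0 th01)).
  by rewrite -powRM ?(ltW t0) ?(ltW B20)// mulrCA divff ?mulr1// gt_eqF.
(* Since [theta + (1 - theta) = 1], the target is the same affine combination of the two endpoint
   bounds. *)
have -> : (B `^ theta * hnorm ip e) ^+ 2 =
    (B ^+ 2) `^ theta * (theta / B ^+ 2 * (B ^+ 2 * hnorm ip e ^+ 2)
                         + (1 - theta) * hnorm ip e ^+ 2).
  rewrite mulrA divfK ?gt_eqF// -mulrDl addrC subrK mul1r exprMn; congr (_ * _).
  by rewrite -!powR_mulrn ?powR_ge0 ?(ltW B0)// -!powRrM mulrC.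
apply: (@le_trans _ _ (\sum_(j < n) (B ^+ 2) `^ theta *
    (theta / B ^+ 2 * (lam j * ip e (psi j) ^+ 2)
     + (1 - theta) * ip e (psi j) ^+ 2))).
  apply: ler_sum => j _.
  apply: le_trans (ler_wpM2r (sqr_ge0 _) (lamB j)) _.
  by rewrite le_eqVlt; apply/orP; left; apply/eqP; ring.
rewrite -mulr_sumr ler_wpM2l ?powR_ge0// big_split/= -!mulr_sumr.
by rewrite lerD// ler_wpM2l// ?divr_ge0 ?subr_ge0// ltW.
Qed.

(** Cauchy-Schwarz in the Parseval sum of [ip w e], with weights [lam^(theta/2)] on [e] and
    [lam^(-theta/2)] on [w]. *)
Lemma residual_bound w e B : H w -> H e -> 0 <= B -> l2 e <= B * hnorm ip e ->
  ip w e = ip e e ->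
  (forall n, \sum_(j < n) lam j `^ (- (1 + theta)) * l2ip w (phi j) ^+ 2
     <= M ^+ 2) ->
  hnorm ip e <= B `^ theta * M.
Proof.
move=> Hw He B0 eB we wM.
have [N0|N0] := eqVneq (hnorm ip e) 0.
  by rewrite N0 mulr_ge0// powR_ge0.
have Ngt0 : 0 < hnorm ip e by rewrite lt_neqAle eq_sym N0 hnorm_ge0.
(* [B = 0] would annihilate all [L_2] coefficients of [e], hence [e] itself. *)
have Bgt0 : 0 < B.
  rewrite lt_neqAle B0 andbT; apply/eqP => B00.
  have : e = 0.
    apply: rkhs_eq0_l2ip => // j.
    have := ler_norm_ip LL (HL He) (Lphi j).
    rewrite l2_phi mulr1 => ej; apply/normr0_eq0/eqP.
    by rewrite eq_le normr_ge0 andbT (le_trans ej)// (le_trans eB)// -B00 mul0r.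
  move=> e0; move: N0; rewrite e0 /hnorm (ip0l HH) ?sqrtr0 ?eqxx//.
  exact: rkhs0 RK.
suff : hnorm ip e ^+ 2 <= B `^ theta * hnorm ip e * M.
  by rewrite expr2 mulrAC ler_pM2r.
rewrite (hnorm_sqr HH)// -we.
rewrite -(cvg_lim _ (parseval Hw He))//; apply: limr_le.
  by apply/cvg_ex; exists (ip w e); exact: parseval.
apply: nearW => n; apply: le_trans (ler_norm _) _.
rewrite -ler_sqr ?nnegrE ?mulr_ge0 ?powR_ge0//; last exact: ltW.
rewrite real_normK ?num_real// [leRHS]exprMn.
have lamh j : lam j `^ (theta / 2) ^+ 2 = lam j `^ theta.
  by rewrite -powR_mulrn ?powR_ge0// -powRrM divfK.
have lamNh j : lam j `^ (- (theta / 2)) ^+ 2 = lam j `^ (- theta).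
  by rewrite -powR_mulrn ?powR_ge0// -powRrM mulNr divfK.
have -> : \sum_(j < n) ip w (psi j) * ip e (psi j) =
    \sum_(j < n) (lam j `^ (theta / 2) * ip e (psi j))
                * (lam j `^ (- (theta / 2)) * ip w (psi j)).
  apply: eq_bigr => j _; rewrite mulrACA -powRD; last first.
    by rewrite (gt_eqF (lam0 j)) implybT.
  by rewrite subrr powRr0 mul1r mulrC.
apply: le_trans (cauchy_schwarz_sum _ _) _.
apply: ler_pM.
- by apply: sumr_ge0 => j _; exact: sqr_ge0.
- by apply: sumr_ge0 => j _; exact: sqr_ge0.
- under eq_bigr do rewrite exprMn lamh; exact: power_weight_bound.
- apply: le_trans (wM n); apply: ler_sum => j _.
  by rewrite l2ip_phi// power_weight exprMn lamNh.
Qed.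

(** The [H] coefficients of [w] must be [c j]; Riesz-Fischer supplies such a [w], and [w - v] then
    has no [L_2] coefficients left. *)
Lemma representative_exists v : L2 v ->
  (forall n, \sum_(j < n) lam j `^ (- (1 + theta)) * l2ip v (phi j) ^+ 2
     <= M ^+ 2) ->
  exists w, representative H v w.
Proof.
move=> v2 vM; pose c j := l2ip v (phi j) / Num.sqrt (lam j).
have vc j : l2ip v (phi j) = Num.sqrt (lam j) * c j.
  by rewrite mulrC divfK// gt_eqF.
have [th0 _] := andP th01.
(* The constant comes from [lam j <= K ^+ 2], which bounds [c j ^+ 2] by [(K ^+ 2)^theta] times the
   power-norm term. *)
have [n|w Hw wc] := @riesz_fischer _ _ _ _ _ psi c
  ((K ^+ 2) `^ theta * M ^+ 2) RK Hpsi psi_o.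
  apply: le_trans (ler_wpM2l (powR_ge0 _ _) (vM n)).
  rewrite mulr_sumr; apply: ler_sum => j _.
  rewrite vc power_weight mulrA -[leLHS]mul1r ler_wpM2r ?sqr_ge0//.
  rewrite powRN ler_pdivlMr ?powR_gt0// mul1r.
  by rewrite ge0_ler_powR ?nnegrE ?sqr_ge0 ?mercer_eigenvalue_le// ltW.
exists w; split=> //; have Ld := sipB LL (HL Hw) v2.
have /ae_eq_onP : ae_eq_on (w - v) 0.
  apply: L2_eq0_l2ip => // j.
  by rewrite (ipBl LL (HL Hw) v2 (Lphi j)) l2ip_phi// wc vc subrr.
move=> wv; apply/ae_eq_onP; apply: filterS wv => x.
rewrite -[w - v]addrC -scaleN1r zext_lin zext0 /= => /eqP.
by rewrite scaleN1r addrC subr_eq0 => /eqP.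
Qed.

(** Both have the [L_2] coefficients of [v], and these determine an element of [H]. *)
Lemma representative_unique v w w' : L2 v -> representative H v w ->
  representative H v w' -> w = w'.
Proof.
move=> v2 [Hw wv] [Hw' wv']; apply/eqP; rewrite -subr_eq0; apply/eqP.
apply: rkhs_eq0_l2ip => [|j]; first exact: (sipB HH).
rewrite (ipBl LL (HL Hw) (HL Hw') (Lphi j)).
rewrite (eq_l2ipl (HL Hw) v2 (Lphi j) wv) (eq_l2ipl (HL Hw') v2 (Lphi j) wv').
by rewrite subrr.
Qed.

End PowerBound.
End PowerSpace.

(** The terms are nonnegative, so partial sums stay below the series, which is finite; [fine] thus
    loses nothing. *)
Lemma power_norm_partial_sum (R : realType) (d : nat) (Omega : set 'rV[R]_d)
    (lam : nat -> R) (phi : nat -> Omega -> R) (theta : R) (f : Omega -> R) n :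
  (power_norm lam phi theta f < +oo)%E ->
  \sum_(j < n) lam j `^ (- theta) * l2ip f (phi j) ^+ 2
    <= fine (power_norm lam phi theta f) ^+ 2.
Proof.
rewrite /power_norm; set s := (\sum_(j <oo) _)%E => soo.
have term0 j : (0 <= (lam j `^ (- theta) * l2ip f (phi j) ^+ 2)%:E)%E.
  by rewrite lee_fin mulr_ge0 ?powR_ge0 ?sqr_ge0.
have s0 : (0 <= s)%E by apply: nneseries_ge0 => j _ _; exact: term0.
have sfin : s \is a fin_num.
  rewrite ge0_fin_numE//; apply: lty_poweRy soo; by rewrite invr_neq0.
have r0 : 0 <= fine s by exact: fine_ge0.
rewrite -(fineK sfin) poweR_EFin/= -powR_mulrn ?powR_ge0// -powRrM mulVf//.
rewrite powRr1// -lee_fin fineK//.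
have : (\sum_(0 <= j < n) (lam j `^ (- theta) * l2ip f (phi j) ^+ 2)%:E <= s)%E.
  by apply: nneseries_lim_ge => j _ _; exact: term0.
by rewrite big_mkord sumEFin.
Qed.

(** * Error bounds in the norm of [H] and in the Sobolev seminorm *)

Theorem corollary16 (R : realType) (d : nat) (Omega : set 'rV[R]_d)
    (q : \bar R) (m : nat) (tau : R) (k : Omega -> Omega -> R)
    (H : set (Omega -> R)) (ip : (Omega -> R) -> (Omega -> R) -> R)
    (lam : nat -> R) (phi : nat -> Omega -> R)
    (Cmq hmq C02 h02 theta : R) :
  bounded_set Omega ->
  lipschitz_boundary Omega ->
  interior_cone_condition Omega ->
  (1 <= q)%E ->
  m%:R + d%:R / 2 < tau ->
  positive_definite k ->
  is_rkhs k H ip ->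
  sobolev_kernel H ip tau ->
  mercer k H ip lam phi ->
  interpolation_bound k H ip tau m q Cmq hmq ->
  interpolation_bound k H ip tau 0 2%:E C02 h02 ->
  0 <= theta <= 1 ->
  forall v, power_space lam phi (1 + theta) v ->
  (exists! w, representative H v w) /\
  forall w, representative H v w ->
    (forall X, finite_set X -> (fill_distance X <= h02%:E)%E ->
       hnorm ip (w - interp k X w)
         <= C02 `^ theta * fine (fill_distance X) `^ (theta * tau)
            * fine (power_norm lam phi (1 + theta) v)) /\
    (forall X, finite_set X -> (fill_distance X <= (Num.min hmq h02)%:E)%E ->
       (wseminorm m q (w - interp k X w)
         <= (Cmq * C02 `^ theta
             * fine (fill_distance X) `^
                 ((1 + theta) * tau - m%:R
                  - d%:R * Num.max 0 (2^-1 - fine (q^-1)%E))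
             * fine (power_norm lam phi (1 + theta) v))%:E)%E).
Proof.
move=> bO _ _ q1 mtau _ RK SK ME IBq IB2 th01 v [v2 _ voo].
have HH := rkhs_semi_inner_product RK.
have LL := L2_semi_inner_product Omega.
have HL f : H f -> L2 f := @rkhs_sub_L2 _ _ _ _ _ _ _ _ _ RK SK ME f.
have [K EK] := rkhs_embedding RK SK ME bO IB2.
pose M := fine (power_norm lam phi (1 + theta) v).
have M0 : 0 <= M by apply: fine_ge0; exact: poweR_ge0.
have vM n :
    \sum_(j < n) lam j `^ (- (1 + theta)) * l2ip v (phi j) ^+ 2 <= M ^+ 2.
  exact: power_norm_partial_sum.
split.
  have [w vw] := representative_exists RK ME HL EK th01 v2 vM.
  by exists w; split=> // w'; exact: (representative_unique RK ME HL EK v2 vw).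
move=> w [Hw wv].
(* The power norm sees only [L_2] coefficients, which [w] shares with [v]. *)
have wM n :
    \sum_(j < n) lam j `^ (- (1 + theta)) * l2ip w (phi j) ^+ 2 <= M ^+ 2.
  apply: le_trans (vM n); apply: ler_sum => j _.
  by rewrite (eq_l2ipl (HL _ Hw) v2 (mercer_L2 ME j) wv).
have [C02_gt0 _ IB2'] := IB2; have [Cmq_gt0 _ IBq'] := IBq.
have Vk x : L2 (k^~ x) by apply: HL; exact: (rkhs_kernel RK).
have part1 X : finite_set X -> (fill_distance X <= h02%:E)%E ->
    hnorm ip (w - interp k X w)
      <= C02 `^ theta * fine (fill_distance X) `^ (theta * tau) * M.
  move=> finX fX; set h := fine (fill_distance X).
  have [L _ LP] := interp_bounded RK LL Vk finX.
  have [HI _ ort _ _] := LP w Hw.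
  set e := w - interp k X w in ort *.
  have He : H e by exact: (sipB HH).
  have -> : C02 `^ theta * h `^ (theta * tau) = (C02 * h `^ tau) `^ theta.
    by rewrite powRM ?powR_ge0 ?(ltW C02_gt0)// -powRrM (mulrC tau).
  apply: (residual_bound RK ME HL EK th01 M0 Hw He) => //.
  - by rewrite mulr_ge0 ?powR_ge0 ?ltW.
  (* For the pair [(0,2)] the exponent reduces to [tau]. *)
  - have := IB2' X finX fX w Hw; rewrite -/e -/h wseminorm0_2; last first.
      exact: L2_measurable (HL _ He).
    rewrite (Lqnorm2E (HL _ He)) lee_fin; congr (_ <= _ * _ `^ _ * _).
    by rewrite inver pnatr_eq0/= subrr maxxx mulr0 !subr0.
  (* [w] is [e] plus its interpolant, and the latter is orthogonal to [e]. *)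
  - rewrite -[w in LHS](subrK (interp k X w)) -/e (ipDl HH)//.
    by rewrite (rkhs_sym RK HI He) ort addr0.
split=> // X finX fX.
have fq : (fill_distance X <= hmq%:E)%E.
  by apply: le_trans fX _; rewrite lee_fin ge_min lexx.
have f2 : (fill_distance X <= h02%:E)%E.
  by apply: le_trans fX _; rewrite lee_fin ge_min lexx orbT.
apply: le_trans (IBq' X finX fq w Hw) _; rewrite lee_fin.
set h := fine (fill_distance X); set b := d%:R * _.
(* With [m + d/2 < tau] this makes the exponent [tau - m - b] positive. *)
have b_le : b <= d%:R / 2.
  rewrite /b ler_wpM2l// ge_max invr_ge0 ler0n/= gerBl fine_ge0//.
  by rewrite inve_ge0 (le_trans _ q1).
have [th0 th1] := andP th01.
have b0 : 0 <= b by rewrite mulr_ge0// le_max lexx.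
have tau0 : 0 < tau - m%:R - b by lra.
have tht0 : 0 <= theta * tau.
  rewrite mulr_ge0//; have : 0 <= m%:R :> R by []; lra.
have -> : (1 + theta) * tau - m%:R - b = (tau - m%:R - b) + theta * tau by ring.
(* For [h = 0] the exponent law requires a nonzero sum of exponents; here the sum is positive. *)
rewrite (@powRD _ h (tau - m%:R - b)); last by rewrite gt_eqF// ltr_wpDr.
apply: le_trans (ler_wpM2l _ (part1 X finX f2)) _.
  by rewrite mulr_ge0 ?powR_ge0 ?(ltW Cmq_gt0).
by rewrite le_eqVlt; apply/orP; left; apply/eqP; rewrite -/h -/M; ring.
Qed.
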